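(* Let $\mathcal{A}=(A_1,\dots,A_k)$, where each $A_i=\{a_{i,1},\dots,a_{i,m_i}\}$ is a multi-subset of $\mathbb{Z}^n$ with $m_i\ge 2$, and let $m=m_1+\cdots+m_k$. The codimension of the tropical resultant $\mathcal{TR}(\mathcal{A})$ in $\mathbb{R}^m$ equals $$k-\max_{E}\dim\Big(\sum_{i=1}^k\mathrm{conv}(E_i)\Big),$$ where $E=(E_1,\dots,E_k)$ and each $E_i$ runs through all cardinality two subsets of $A_i$.
   Context: Points in $A_i$ need not be distinct (they are labeled, and a cardinality two subset means two distinct labels); $\sum$ denotes Minkowski sum. A tropical polynomial with support $A_i$ is $F_i(x)=\min_j(c_{ij}+a_{ij}\cdot x)$, with coefficients $(c_{ij})_j\in\mathbb{R}^{A_i}=\mathbb{R}^{m_i}$. Its tropical solution set $\mathcal{T}(F_i)\subseteq\mathbb{R}^n$ is the set of $x$ at which the minimum is attained by at least two indices $j$. The tropical resultant $\mathcal{TR}(\mathcal{A})\subseteq\mathbb{R}^m=\prod_i\mathbb{R}^{A_i}$ is the set of tuples $(F_1,\dots,F_k)$ with $\bigcap_i\mathcal{T}(F_i)\neq\emptyset$; it is a finite union of polyhedral cones, and its dimension is the maximal dimension of such a cone. *)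

(* Defs.v *)
From HB Require Import structures.
From mathcomp Require Import all_boot all_order all_algebra.
From mathcomp Require Import boolp classical_sets reals convex.

Set Implicit Arguments.
Unset Strict Implicit.
Unset Printing Implicit Defensive.

Import Order.TTheory GRing.Theory Num.Theory.

Local Open Scope classical_set_scope.
Local Open Scope ring_scope.

(* [V] is the direction of the affine hull of [S]: the smallest linear subspace
   containing all the differences of points of [S]. *)
Definition is_direction (K : fieldType) (vT : vectType K) (S : set vT)
    (V : {vspace vT}) : Prop :=
  (forall x y, S x -> S y -> x - y \in V) /\
  (forall W : {vspace vT},
     (forall x y, S x -> S y -> x - y \in W) -> (V <= W)%VS).

Definition direction (K : fieldType) (vT : vectType K) (S : set vT) :
    {vspace vT} :=
  xget 0%VS (is_direction S).

Lemma directionP (K : fieldType) (vT : vectType K) (S : set vT) :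
  is_direction S (direction S).
Proof.
rewrite /direction; case: xgetP => [V _ //|noV]; exfalso.
pose P (W : {vspace vT}) := forall x y, S x -> S y -> x - y \in W.
pose p := [pred d | `[< exists2 W, P W & \dim W = d >]].
have exp : exists d, p d.
  by exists (\dim {:vT}); apply/asboolP; exists fullv => // x y _ _; apply: memvf.
have [d /asboolP[V PV dV] dmin] := ex_minnP exp.
apply: (noV V); split=> // W PW.
have PVW : P (V :&: W)%VS by move=> x y Sx Sy; rewrite memv_cap PV ?PW.
have /dmin le_d : p (\dim (V :&: W)%VS) by apply/asboolP; exists (V :&: W)%VS.
apply/capv_idPl/eqP.
by rewrite eqEdim capvSl dV.
Qed.

(* The dimension of the affine hull; only meaningful for nonempty sets (the
   empty set gets 0 by convention). *)
Definition affdim (K : fieldType) (vT : vectType K) (S : set vT) : nat :=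
  \dim (direction S).

Section Tropical.
Context {R : realType}.

Definition polyhedral_cone (N : nat) (C : set 'rV[R]_N) : Prop :=
  exists (p : nat) (M : 'M[R]_(N, p)),
    C = [set c | forall i, 0 <= (c *m M) ord0 i].

Definition cone_decomposition (N : nat) (S : set 'rV[R]_N) (p : nat)
    (C : 'I_p -> set 'rV[R]_N) : Prop :=
  (forall i, polyhedral_cone (C i)) /\ S = \bigcup_(i in [set: 'I_p]) C i.

(* [has_dim S d] includes the facts that [S] is a finite union of polyhedral
   cones and that the dimension does not depend on the chosen cones. *)
Definition has_dim (N : nat) (S : set 'rV[R]_N) (d : nat) : Prop :=
  (exists (p : nat) (C : 'I_p -> set 'rV[R]_N), cone_decomposition S C) /\
  (forall (p : nat) (C : 'I_p -> set 'rV[R]_N),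
     cone_decomposition S C -> (\max_(i < p) affdim (C i))%N = d).

Definition has_codim (N : nat) (S : set 'rV[R]_N) (e : int) : Prop :=
  exists2 d : nat, has_dim S d & e = N%:Z - d%:Z.

Definition conv_hull (M : lmodType R) (X : set M) : set M :=
  smallest (@convex_set R M) X.

Definition minkowski_sum (k : nat) (M : lmodType R) (X : 'I_k -> set M) :
    set M :=
  [set \sum_(i < k) y i | y in [set y : 'I_k -> M | forall i, X i (y i)]].

(* The multi-subset {a_1, ..., a_mi} of Z^n is the family of its points, indexed
   by labels: repeated points carry distinct labels. *)
Definition real_point (n : nat) (v : 'rV[int]_n) : 'rV[R]_n :=
  map_mx (fun z : int => z%:~R) v.

Definition trop_term (n mi : nat) (A : 'I_mi -> 'rV[int]_n) (c : 'rV[R]_mi)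
    (x : 'rV[R]_n) (j : 'I_mi) : R :=
  c ord0 j + \sum_(l < n) real_point (A j) ord0 l * x ord0 l.

(* The labels at which the minimum F(x) of the terms is attained. *)
Definition trop_argmin (n mi : nat) (A : 'I_mi -> 'rV[int]_n)
    (c : 'rV[R]_mi) (x : 'rV[R]_n) : {set 'I_mi} :=
  [set j | [forall l, trop_term A c x j <= trop_term A c x l]]%SET.

Definition trop_solutions (n mi : nat) (A : 'I_mi -> 'rV[int]_n)
    (c : 'rV[R]_mi) : set 'rV[R]_n :=
  [set x | (2 <= #|trop_argmin A c x|)%N].

(* A point [c] of R^m = R^(m_1) x ... x R^(m_k) is a row vector; its i-th block
   [submxrow c i] is the coefficient vector of the i-th polynomial. *)
Definition trop_resultant (n k : nat) (m : 'I_k -> nat)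
    (A : forall i : 'I_k, 'I_(m i) -> 'rV[int]_n) :
    set 'rV[R]_(\sum_(i < k) m i) :=
  [set c | \bigcap_(i in [set: 'I_k]) trop_solutions (A i) (submxrow c i)
           !=set0].

Definition labelled_points (n mi : nat) (A : 'I_mi -> 'rV[int]_n)
    (E : {set 'I_mi}) : set 'rV[R]_n :=
  [set real_point (A j) | j in [set` E]].

End Tropical.

(* Main.v *)
(** For a choice E of pairs {p_i, q_i}, let C_E be the set of tuples for which
    some point x makes both labels of every E_i minimal. Then TR(A) is the union
    of the C_E. Each C_E is the projection along x of a polyhedral cone in the
    variables (c, x), hence polyhedral by Fourier-Motzkin elimination, and it
    spans the space of all c whose differences (c_{i,p_i} - c_{i,q_i})_i lie in
    the image of x |-> ((a_{i,q_i} - a_{i,p_i}) . x)_i. Since c |-> (c_{i,p_i} -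
    c_{i,q_i})_i is onto R^k, this space has codimension k - rank(D_E), where
    the rows of D_E are the vectors a_{i,q_i} - a_{i,p_i}; these vectors also
    span the direction of the Minkowski sum of the segments. The dimension does
    not depend on the decomposition into cones because a convex cone covered by
    finitely many linear subspaces lies in one of them. *)

Require Import Defs.
From HB Require Import structures.
From mathcomp Require Import all_boot all_order all_algebra.
From mathcomp Require Import boolp classical_sets reals convex.
From mathcomp Require Import interval_inference lra.

Set Implicit Arguments.
Unset Strict Implicit.
Unset Printing Implicit Defensive.

Import Order.TTheory GRing.Theory Num.Theory.

Local Open Scope classical_set_scope.
Local Open Scope ring_scope.

(** * Fourier-Motzkin elimination *)

Section FourierMotzkin.
Context {R : realType}.
Implicit Type I : finType.

(** The largest lower bound works; without lower bounds, the smallest upper bound does, and 0 if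
    there are no bounds at all. *)
Lemma finite_interpolation I (P Q : pred I) (L U : I -> R) :
  (forall i j, P i -> Q j -> L i <= U j) ->
  exists t, (forall i, P i -> L i <= t) /\ (forall j, Q j -> t <= U j).
Proof.
move=> LU; case: (pickP P) => [i0 Pi0|P0].
  exists (L [arg max_(i > i0 | P i) L i]%O).
  by case: arg_maxP => // i Pi Li; split=> // j; apply: LU.
case: (pickP Q) => [j0 Qj0|Q0].
  exists (U [arg min_(j < j0 | Q j) U j]%O).
  by case: arg_minP => // j Qj Uj; split=> // i; rewrite P0.
by exists 0; split=> i; rewrite ?P0 ?Q0.
Qed.

(* Nonnegative weights whose combination of the slopes [x] and [y] vanishes. *)
Definition fm_weights (x y : R) : R * R :=
  if (0 < x) && (y < 0) then (- y, x) else ((x == 0)%:R, 0).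

(** A positive slope bounds [t] from below, a negative one from above. The weighted inequality for
    such a pair says that its two bounds are compatible. *)
Lemma fourier_motzkin_step I (a b : I -> R) :
  (exists t, forall i, 0 <= a i + t * b i) <->
  (forall i j, 0 <= (fm_weights (b i) (b j)).1 * a i
                  + (fm_weights (b i) (b j)).2 * a j).
Proof.
split=> [[t ht] i j|H].
  rewrite /fm_weights; have hi := ht i; have hj := ht j.
  case: ifP => [/andP[bi bj]|_] /=; first by nra.
  by case: eqP hi => [->|_]; rewrite ?mulr0 ?mul1r !mul0r addr0.
have LU i j : 0 < b i -> b j < 0 -> - a i / b i <= a j / - b j.
  move=> bi bj; have := H i j; rewrite /fm_weights bi bj /= => hij.
  rewrite ler_pdivrMr // mulrAC ler_pdivlMr ?oppr_gt0 //; nra.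
have [t [tL tU]] := finite_interpolation LU.
exists t => i; have [b0|bp|b0] := ltgtP (b i) 0.
- have := tU i b0; rewrite ler_pdivlMr ?oppr_gt0 //; nra.
- have := tL i bp; rewrite ler_pdivrMr //; nra.
(* At slope 0 the weights are (1, 0), so the diagonal pair returns [0 <= a i]. *)
have := H i i; rewrite /fm_weights b0 ltxx eqxx /=; lra.
Qed.

Lemma polyhedral_cone_fin I N (f : I -> 'cV[R]_N) :
  polyhedral_cone [set c : 'rV_N | forall i, 0 <= (c *m f i) 0 0].
Proof.
exists #|I|, (\matrix_(l, j) f (enum_val j) l 0).
have E c (j : 'I_#|I|) :
    (c *m \matrix_(l, j) f (enum_val j) l 0) 0 j = (c *m f (enum_val j)) 0 0.
  by rewrite !mxE; apply: eq_bigr => l _; rewrite !mxE.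
apply/seteqP; split=> c /= H i; first by rewrite E.
by rewrite -[i]enum_rankK -E.
Qed.

Lemma mulmx_split1 n (u : 'rV[R]_(1 + n)) (v : 'cV[R]_(1 + n)) :
  (u *m v) 0 0 = u 0 0 * v 0 0 + (rsubmx u *m dsubmx v) 0 0.
Proof.
rewrite -{1}[u]hsubmxK -{1}[v]vsubmxK mul_row_col [LHS]mxE; congr (_ + _).
rewrite mxE big_ord1 !mxE; congr (u _ _ * v _ _); exact: val_inj.
Qed.

(** Induction on [n]: eliminating the first coordinate of [x] leaves inequalities indexed by
    [I * I], hence the generality in [I]. *)
Lemma polyhedral_cone_proj I N n (f : I -> 'cV[R]_N) (g : I -> 'cV[R]_n) :
  polyhedral_cone
    [set c : 'rV_N | exists x : 'rV_n, forall i, 0 <= (c *m f i) 0 0 + (x *m g i) 0 0].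
Proof.
elim: n I f g => [|n IHn] I f g.
  suff -> : [set c : 'rV_N | exists x : 'rV_0, forall i,
      0 <= (c *m f i) 0 0 + (x *m g i) 0 0] =
      [set c : 'rV_N | forall i, 0 <= (c *m f i) 0 0] by apply: polyhedral_cone_fin.
  apply/seteqP; split=> [c [x H] i|c H]; last exists 0 => i.
    by have := H i; rewrite [x]thinmx0 mul0mx [X in _ + X]mxE addr0.
  by rewrite mul0mx [X in _ + X]mxE addr0.
pose g0 i : R := g i 0 0.
pose g' i : 'cV_n := dsubmx (g i : 'cV_(1 + n)).
pose w (p : I * I) := fm_weights (g0 p.1) (g0 p.2).
pose comb M (h : I -> 'cV[R]_M) p := (w p).1 *: h p.1 + (w p).2 *: h p.2.
have combE M (h : I -> 'cV[R]_M) (c : 'rV_M) p :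
    (c *m comb _ h p) 0 0 =
    (w p).1 * (c *m h p.1) 0 0 + (w p).2 * (c *m h p.2) 0 0.
  by rewrite /comb mulmxDr -!scalemxAr !mxE.
have gE (x : 'rV_(1 + n)) i :
    (x *m (g i : 'cV_(1 + n))) 0 0 = x 0 0 * g0 i + (rsubmx x *m g' i) 0 0.
  exact: mulmx_split1.
have := IHn _ (comb _ f) (comb _ g'); congr polyhedral_cone.
apply/seteqP; split=> [c [x Hx]|c [x Hx]] /=.
  have /fourier_motzkin_step[t Ht] i j : 0 <=
      (fm_weights (g0 i) (g0 j)).1 * ((c *m f i) 0 0 + (x *m g' i) 0 0)
    + (fm_weights (g0 i) (g0 j)).2 * ((c *m f j) 0 0 + (x *m g' j) 0 0).
    by have := Hx (i, j); rewrite !combE /w /=; lra.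
  exists (row_mx t%:M x : 'rV_(1 + n)) => i; have := Ht i.
  rewrite (gE (row_mx t%:M x)) row_mxKr.
  suff -> : (row_mx t%:M x : 'rV_(1 + n)) 0 0 = t by lra.
  by rewrite mxE; case: splitP => j //= _; rewrite ord1 mxE eqxx.
have {}Hx : exists t, forall i,
    0 <= ((c *m f i) 0 0 + (rsubmx (x : 'rV_(1 + n)) *m g' i) 0 0) + t * g0 i.
  by exists ((x : 'rV_(1 + n)) 0 0) => i; have := Hx i; rewrite (gE x); lra.
exists (rsubmx (x : 'rV_(1 + n))) => p.
move/fourier_motzkin_step: Hx => /(_ p.1 p.2).
by rewrite !combE /w; lra.
Qed.

End FourierMotzkin.

(** * Dimension of finite unions of polyhedral cones *)

Section ConeDimension.
Context {R : realType} {N : nat}.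
Implicit Types C S : set 'rV[R]_N.

Lemma direction_sub S x y : S x -> S y -> x - y \in direction S.
Proof. by have [+ _] := directionP S; exact. Qed.

Lemma direction_min S (W : {vspace 'rV[R]_N}) :
  (forall x y, S x -> S y -> x - y \in W) -> (direction S <= W)%VS.
Proof. by have [_ +] := directionP S; exact. Qed.

Lemma polyhedral_cone0 C : polyhedral_cone C -> C 0.
Proof. by move=> [p [M ->]] i /=; rewrite mul0mx mxE. Qed.

Lemma polyhedral_coneD C x y :
  polyhedral_cone C -> C x -> C y -> C (x + y).
Proof.
move=> [p [M ->]] /= Cx Cy i; rewrite mulmxDl [X in 0 <= X]mxE.
by rewrite addr_ge0.
Qed.

Lemma polyhedral_coneMn C x k : polyhedral_cone C -> C x -> C (x *+ k).
Proof.
move=> pC Cx; elim: k => [|k IHk]; first exact: polyhedral_cone0.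
by rewrite mulrS; apply: polyhedral_coneD.
Qed.

(* Among the points [u + t v] with [v] outside the last subspace, two lie in a
   common subspace, which must then contain both [u] and [v]. *)
Lemma cone_cover C p (W : 'I_p -> {vspace 'rV[R]_N}) :
  polyhedral_cone C -> (forall x, C x -> exists i, x \in W i) ->
  exists i, forall x, C x -> x \in W i.
Proof.
move=> pC; elim: p W => [|p IHp] W cov.
  by have [[]] := cov 0 (polyhedral_cone0 pC).
have [CW|/existsNP[v /not_implyP[Cv vW]]] :=
  pselect (forall x, C x -> x \in W ord_max); first by exists ord_max.
suff [i CW] : exists i, forall x, C x -> x \in W (lift ord_max i).
  by exists (lift ord_max i).
apply: IHp => u Cu.
(* With p + 2 values of [t] and only p + 1 subspaces, two values must share one. *)
have /choice[f fP] (t : 'I_p.+2) : exists i, u + v *+ t \in W i.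
  by apply: cov; apply: polyhedral_coneD => //; apply: polyhedral_coneMn.
have /injectivePn[s [t st fst]] : ~~ injectiveb f.
  by apply/injectiveP => /leq_card; rewrite !card_ord ltnn.
wlog lt_st : s t st fst / (s < t)%N.
  move=> wl; case: (ltngtP s t) => [|ts|/val_inj/eqP].
  - exact: wl.
  - by apply: (wl t s); rewrite // eq_sym.
  - by rewrite (negPf st).
have vWs : v \in W (f s).
  have : (u + v *+ t) - (u + v *+ s) \in W (f s).
    by rewrite rpredB // fst.
  rewrite opprD addrACA subrr add0r -mulrnBr ?(ltnW lt_st) //.
  by rewrite -scaler_nat rpredZeq pnatr_eq0 subn_eq0 leqNgt lt_st.
have uWs : u \in W (f s).
  by rewrite -(addrK (v *+ s) u) rpredB ?rpredMn.
case: (unliftP ord_max (f s)) => [i Ei|Ei]; first by exists i; rewrite -Ei.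
by rewrite Ei in vWs.
Qed.

(** Cones contain 0, so each [D j] lies in its own direction; [C i] is covered by these directions
    and lies in one of them by [cone_cover]. *)
Lemma cone_decomposition_leq S p q (C : 'I_p -> set 'rV[R]_N)
    (D : 'I_q -> set 'rV[R]_N) :
  cone_decomposition S C -> cone_decomposition S D ->
  (\max_(i < p) affdim (C i) <= \max_(j < q) affdim (D j))%N.
Proof.
move=> [pC SC] [pD SD]; apply/bigmax_leqP => i _.
have [j CD] : exists j, forall x, C i x -> x \in direction (D j).
  apply: (cone_cover (pC i)) => x Cx.
  have : S x by rewrite SC; exists i.
  rewrite SD => -[j _ Dx]; exists j; rewrite -[x]subr0.
  by apply: direction_sub => //; apply: polyhedral_cone0.
apply: leq_trans (leq_bigmax j); apply/dimvS/direction_min => x y Cx Cy.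
by rewrite rpredB ?CD.
Qed.

Lemma cone_decomposition_has_dim S p (C : 'I_p -> set 'rV[R]_N) :
  cone_decomposition S C -> has_dim S (\max_(i < p) affdim (C i))%N.
Proof.
move=> SC; split=> [|q D SD]; first by exists p, C.
by apply/eqP; rewrite eqn_leq !(@cone_decomposition_leq S).
Qed.

End ConeDimension.

(** * Ranks and dimensions of images and preimages *)

Section RankDimension.
Context {F : fieldType}.

Lemma memv_limg_mulmxr p q (M : 'M[F]_(p, q)) (y : 'rV_q) :
  reflect (exists x : 'rV_p, y = x *m M) (y \in limg (linfun (mulmxr M))).
Proof.
apply: (iffP memv_imgP) => [[x _ ->]|[x ->]]; exists x; rewrite ?memvf //.
  by rewrite lfunE.
by rewrite lfunE.
Qed.

(** [row_base M] gives the same image through an injective map defined on a space of dimension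
    [\rank M]. *)
Lemma dim_limg_mulmxr p q (M : 'M[F]_(p, q)) :
  \dim (limg (linfun (mulmxr M) : 'Hom('rV_p, 'rV_q))) = \rank M.
Proof.
have -> : limg (linfun (mulmxr M) : 'Hom('rV_p, 'rV_q)) =
          limg (linfun (mulmxr (row_base M)) : 'Hom('rV_(\rank M), 'rV_q)).
  have /submxP[X XM] : (row_base M <= M)%MS by rewrite eq_row_base.
  apply/vspaceP => y; apply/memv_limg_mulmxr/memv_limg_mulmxr => -[x ->].
    by exists (x *m col_base M); rewrite -mulmxA mulmx_base.
  by exists (x *m X); rewrite -mulmxA -XM.
rewrite limg_dim_eq; first by rewrite dimvf /dim /= mul1n.
apply/eqP; rewrite -subv0; apply/subvP => x; rewrite memv_cap memvf /=.
rewrite memv_ker lfunE /= memv0 => /eqP xM.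
by rewrite (row_free_inj (row_base_free M) (etrans xM (esym (mul0mx _ _)))).
Qed.

(** Rank-nullity for [f] on the preimage and on the whole space; both contain the kernel, which
    cancels. *)
Lemma dim_preim_limg (U V W : vectType F) (f : 'Hom(U, V)) (g : 'Hom(W, V)) :
  limg f = fullv ->
  (\dim (f @^-1: limg g) + \dim {:V} = \dim {:U} + \dim (limg g))%N.
Proof.
move=> f_surj.
have kerS : (lker f <= f @^-1: limg g)%VS.
  apply/subvP => u; rewrite memv_ker -memv_preim => /eqP ->.
  exact: mem0v.
have := limg_ker_dim f (f @^-1: limg g).
rewrite (capv_idPr kerS) lpreimK ?f_surj ?subvf // => <-.
have := limg_ker_dim f fullv.
by rewrite (capv_idPr (subvf _)) f_surj => <-; rewrite addnAC.
Qed.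

End RankDimension.

(** * Minkowski sums of segments *)

Section MinkowskiSum.
Context {R : realType} {n : nat}.

(** The translate [u + W] is convex, so it contains the hull as soon as it contains [X]. *)
Lemma conv_hull_subv (X : set 'rV[R]_n) u (W : {vspace 'rV[R]_n}) :
  (forall y, X y -> y - u \in W) -> forall y, conv_hull X y -> y - u \in W.
Proof.
move=> XW; apply: (@smallest_sub _ (@convex_set R _) X [set y | y - u \in W]).
  move=> x y t; rewrite !inE /= => xW yW.
  have -> : conv t x y - u = t%:num *: (x - u) + (1 - t%:num) *: (y - u).
    rewrite !scalerBr addrACA -opprD -scalerDl [t%:num + _]addrC subrK scale1r.
    by [].
  by rewrite rpredD ?rpredZ.
exact: XW.
Qed.

Lemma affdim_minkowski_sum k (X : 'I_k -> set 'rV[R]_n) (u v : 'I_k -> 'rV_n) :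
  (forall i, X i = [set u i; v i]) ->
  affdim (minkowski_sum (fun i => conv_hull (X i))) =
    \rank (\matrix_(i < k) (v i - u i)).
Proof.
move=> XE; set D := \matrix_(i < k) (v i - u i).
have Xhull i y : X i y -> conv_hull (X i) y by apply: sub_gen_smallest.
have Xu i : X i (u i) by rewrite XE; left.
have Xv i : X i (v i) by rewrite XE; right.
rewrite -dim_limg_mulmxr /affdim; congr (\dim _); apply/eqP.
rewrite eqEsubv; apply/andP; split.
  set W := limg _.
  have dW i : v i - u i \in W.
    by apply/memv_limg_mulmxr; exists (delta_mx 0 i); rewrite -rowE rowK.
  have hullW i y : conv_hull (X i) y -> y - u i \in W.
    apply: conv_hull_subv => {}y; rewrite XE => -[->|->] //.
    by rewrite subrr mem0v.
  have [_] := directionP (minkowski_sum (fun i => conv_hull (X i))); apply.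
  move=> _ _ [y /= Xy <-] [z /= Xz <-]; rewrite -sumrB memv_suml // => i _.
  have -> : y i - z i = (y i - u i) - (z i - u i) by rewrite opprB addrA subrK.
  by rewrite rpredB ?hullW.
apply/subvP => _ /memv_limg_mulmxr[w ->].
rewrite mulmx_sum_row memv_suml // => i _; rewrite memvZ // rowK.
(* Moving only the i-th summand from [u i] to [v i] realizes row i as a difference of two points of
   the sum. *)
pose y j := if j == i then v j else u j.
have -> : v i - u i = \sum_j y j - \sum_j u j.
  rewrite -sumrB (bigD1 i) //= /y eqxx big1 ?addr0 // => j /negPf ->.
  by rewrite subrr.
have [dirP _] := directionP (minkowski_sum (fun i => conv_hull (X i))).
apply: dirP; last by exists u => //= j; apply: Xhull.
by exists y => //= j; rewrite /y; case: ifP => _; apply: Xhull.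
Qed.

End MinkowskiSum.

Lemma sum_coef_delta (R : pzRingType) M (c : 'rV[R]_M) s0 :
  \sum_s c 0 s * (s == s0)%:R = c 0 s0.
Proof.
rewrite (bigD1 s0) //= eqxx mulr1 big1 ?addr0 // => s /negPf ->.
by rewrite mulr0.
Qed.

(** * Decomposition of the resultant into polyhedral cells *)

Section TropicalCells.
Context {R : realType} {n k : nat} {m : 'I_k -> nat}.
Variable A : forall i : 'I_k, 'I_(m i) -> 'rV[int]_n.

Local Notation N := (\sum_(i < k) m i)%N.
Local Notation coef c i j := (c 0 (tagnat.Rank i j)).

Definition block_term (c : 'rV[R]_N) (x : 'rV[R]_n) i j : R :=
  trop_term (@A i) (submxrow c i) x j.

(** Inclusion rather than equality: further labels may attain the minimum, so only weak inequalities
    occur. *)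
Definition trop_cell (E : forall i, {set 'I_(m i)}) : set 'rV[R]_N :=
  [set c | exists x,
     forall i, E i \subset trop_argmin (@A i) (submxrow c i) x].

Lemma block_termE c x i (j : 'I_(m i)) :
  block_term c x j = coef c i j + (x *m (real_point (A j))^T) 0 0.
Proof.
rewrite /block_term /trop_term !mxE; congr (_ + _).
by apply: eq_bigr => l _; rewrite !mxE mulrC.
Qed.

Lemma block_termD c d x y i (j : 'I_(m i)) :
  block_term (c + d) (x + y) j = block_term c x j + block_term d y j.
Proof. by rewrite !block_termE mulmxDl !mxE addrACA. Qed.

Lemma trop_cellP (E : forall i, {set 'I_(m i)}) c :
  trop_cell E c <-> exists x, forall i (j l : 'I_(m i)),
    j \in E i -> block_term c x j <= block_term c x l.
Proof.
split=> -[x H]; exists x => i.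
  by move=> j l /(fintype.subsetP (H i)); rewrite inE => /forallP/(_ l).
by apply/fintype.subsetP => j Ej; rewrite inE; apply/forallP => l; apply: H.
Qed.

Lemma trop_resultantE :
  @trop_resultant R n k m A =
  \bigcup_(E in [set E : {dffun forall i : 'I_k, {set 'I_(m i)}} |
                   [forall i, #|E i| == 2%N]]) trop_cell E.
Proof.
apply/seteqP; split=> c.
  move=> [x Hx]; have pairs (i : 'I_k) : exists E : {set 'I_(m i)},
      E \subset trop_argmin (@A i) (submxrow c i) x /\ #|E| == 2%N.
    have /card_gt1P[p [q [xp xq pq]]] := Hx i I.
    exists [set p; q]%SET; rewrite cards2 pq; split=> //.
    by apply/fintype.subsetP => j /set2P[] ->.
  have [E HE] := fin_all_exists pairs.
  exists [ffun i => E i] => /=.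
    by apply/forallP => i; rewrite ffunE; case: (HE i).
  by exists x => i; rewrite ffunE; case: (HE i).
move=> [E /= /forallP E2 [x Hx]]; exists x => i _.
by rewrite /trop_solutions /= -(eqP (E2 i)) subset_leq_card.
Qed.

Lemma polyhedral_trop_cell (E : forall i, {set 'I_(m i)}) :
  polyhedral_cone (trop_cell E).
Proof.
pose I := {i : 'I_k & ('I_(m i) * 'I_(m i))%type}.
(* The factor [b] makes the inequality for (i, j, l) trivial when [j] is not in [E i]. *)
pose b (t : I) : R := ((tagged t).1 \in E (tag t))%:R.
pose f (t : I) : 'cV[R]_N := b t *:
  (delta_mx (tagnat.Rank (tag t) (tagged t).2) 0
   - delta_mx (tagnat.Rank (tag t) (tagged t).1) 0).
pose g (t : I) : 'cV[R]_n := b t *: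
  ((real_point (A (tagged t).2))^T - (real_point (A (tagged t).1))^T).
have fgE c x t : (c *m f t) 0 0 + (x *m g t) 0 0 =
    b t * (block_term c x (tagged t).2 - block_term c x (tagged t).1).
  rewrite !block_termE -!scalemxAr !mulmxBr -!colE.
  by do 9![rewrite mxE]; lra.
have := polyhedral_cone_proj f g; congr polyhedral_cone.
apply/seteqP; split=> c /=.
  move=> [x Hx]; apply/trop_cellP; exists x => i j l Ej.
  by have := Hx (Tagged _ (j, l)); rewrite fgE /b /= Ej mul1r subr_ge0.
move=> /trop_cellP[x Hx]; exists x => -[i [j l]]; rewrite fgE /b /=.
by case: (boolP (j \in E i)) => Ej; rewrite ?mul0r // mul1r subr_ge0 Hx.
Qed.

(** * Linear span of a cell *)

Section CellDirection.
Variables p q : forall i : 'I_k, 'I_(m i).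
Hypothesis pq : forall i, p i != q i.
Local Notation pair_set := (fun i => [set p i; q i]%SET).

Definition pair_diff : 'M[R]_(N, k) :=
  \matrix_(s, i) ((s == tagnat.Rank i (p i))%:R
                  - (s == tagnat.Rank i (q i))%:R).

(** The order is opposite to that of [pair_diff]: the terms at [p i] and [q i] agree when c_p - c_q
    = (a_q - a_p) . x. *)
Definition exponent_diff : 'M[R]_(k, n) :=
  \matrix_(i < k) (real_point (A (q i)) - real_point (A (p i))).

(** Only the two chosen terms of each polynomial are made equal; the remaining labels are
    unconstrained. The form as a preimage serves the dimension count. *)
Definition pair_space : {vspace 'rV[R]_N} :=
  ((linfun (mulmxr pair_diff) : 'Hom('rV_N, 'rV_k)) @^-1:
   limg (linfun (mulmxr exponent_diff^T) : 'Hom('rV_n, 'rV_k)))%VS.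

Lemma mul_pair_diff (c : 'rV_N) i :
  (c *m pair_diff) 0 i = coef c i (p i) - coef c i (q i).
Proof.
have sumE := sum_coef_delta c.
rewrite mxE -!sumE -sumrB; apply: eq_bigr => s _.
by rewrite mxE mulrBr.
Qed.

Lemma mul_exponent_diff (x : 'rV_n) i : (x *m exponent_diff^T) 0 i =
  (x *m (real_point (A (q i)))^T) 0 0 - (x *m (real_point (A (p i)))^T) 0 0.
Proof.
rewrite !mxE -sumrB; apply: eq_bigr => l _.
by rewrite !mxE mulrBr.
Qed.

Lemma pair_spaceP c : reflect
  (exists x, forall i, block_term c x (p i) = block_term c x (q i))
  (c \in pair_space).
Proof.
rewrite -memv_preim lfunE /=; apply: (iffP (memv_limg_mulmxr _ _)).
  move=> [x cx]; exists x => i; move/rowP/(_ i): cx.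
  by rewrite mul_pair_diff mul_exponent_diff !block_termE; lra.
move=> [x cx]; exists x; apply/rowP => i; move: (cx i).
by rewrite mul_pair_diff mul_exponent_diff !block_termE; lra.
Qed.

(** Put [y 0 i] at label [p i] and 0 at all others; [q i] then carries 0 because it differs from
    [p i]. *)
Lemma limg_pair_diff :
  limg (linfun (mulmxr pair_diff) : 'Hom('rV_N, 'rV_k)) = fullv.
Proof.
apply/vspaceP => y; rewrite memvf; apply/memv_limg_mulmxr.
exists (\mxrow_i \row_j (y 0 i * (j == p i)%:R)).
have coefE i j : coef (\mxrow_i \row_j (y 0 i * (j == p i)%:R)) i j
    = y 0 i * (j == p i)%:R.
  transitivity (submxrow (\mxrow_i \row_j (y 0 i * (j == p i)%:R)) i 0 j).
    by rewrite [RHS]mxE.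
  by rewrite mxrowK mxE.
apply/rowP => i; rewrite mul_pair_diff !coefE eqxx eq_sym (negPf (pq i)).
by rewrite mulr0 subr0 mulr1.
Qed.

Lemma dim_pair_space :
  (\dim pair_space + k = N + \rank exponent_diff)%N.
Proof.
have := dim_preim_limg (linfun (mulmxr exponent_diff^T) : 'Hom('rV_n, 'rV_k))
  limg_pair_diff.
by rewrite dim_limg_mulmxr mxrank_tr !dimvf /dim /= !mul1n.
Qed.

(* Adding to [c] the coefficients [T] away from the chosen pairs makes the
   chosen pairs minimal, so [c] is a difference of two points of the cell. *)
Lemma direction_trop_cell : direction (trop_cell pair_set) = pair_space.
Proof.
have cell_pair c : trop_cell pair_set c -> c \in pair_space.
  move=> /trop_cellP[x Hx]; apply/pair_spaceP; exists x => i; apply/eqP.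
  by rewrite eq_le !Hx ?set21 ?set22.
apply/eqP; rewrite eqEsubv; apply/andP; split.
  by apply: direction_min => c d /cell_pair Lc /cell_pair Ld; apply: rpredB.
apply/subvP => c /pair_spaceP[x cx].
pose gap i (l : 'I_(m i)) := `|block_term c x l - block_term c x (p i)|.
pose T := \sum_i \sum_l gap i l.
have gap_ge0 i l : 0 <= gap i l by apply: normr_ge0.
have T_ge0 : 0 <= T by apply: sumr_ge0 => i _; apply: sumr_ge0.
have gapT i l : gap i l <= T.
  rewrite /T (bigD1 i) //= (bigD1 l) //= -addrA lerDl addr_ge0 //.
    by apply: sumr_ge0.
  by apply: sumr_ge0 => j _; apply: sumr_ge0.
pose d : 'rV[R]_N := \mxrow_i \row_j (if j \in pair_set i then 0 else T).
have dE i (j : 'I_(m i)) : block_term d 0 j = if j \in pair_set i then 0 else T.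
  rewrite block_termE mul0mx [X in _ + X]mxE addr0.
  transitivity (submxrow d i 0 j); first by rewrite [RHS]mxE.
  by rewrite mxrowK mxE.
rewrite -[c](addrK d); apply: direction_sub; apply/trop_cellP.
  exists (x + 0) => i j l Ej; rewrite !block_termD !dE Ej addr0.
  have -> : block_term c x j = block_term c x (p i).
    by case/set2P: Ej => ->.
  case: ifP => [/set2P[]->|_]; rewrite ?addr0 //; first by rewrite cx.
  have := gapT i l; rewrite /gap ler_norml => /andP[]; lra.
by exists 0 => i j l Ej; rewrite !dE Ej; case: ifP.
Qed.

End CellDirection.

Lemma affdim_trop_cell (E : forall i, {set 'I_(m i)}) :
  (forall i, #|E i| = 2%N) ->
  (affdim (trop_cell E) + k = N + affdim (minkowski_sum
     (fun i => conv_hull (@labelled_points R n (m i) (@A i) (E i)))))%N.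
Proof.
move=> E2; have pairs i : exists pq : 'I_(m i) * 'I_(m i),
    pq.1 != pq.2 /\ E i = [set pq.1; pq.2]%SET.
  by have /eqP/cards2P[p [q [pq ->]]] := E2 i; exists (p, q).
have [pq HE] := fin_all_exists pairs.
pose p i := (pq i).1; pose q i := (pq i).2.
have Epq i : E i = [set p i; q i]%SET by case: (HE i).
have neq_pq i : p i != q i by case: (HE i).
rewrite (_ : trop_cell E = trop_cell (fun i => [set p i; q i]%SET)); last first.
  by apply/seteqP; split=> c [x H]; exists x => i; move: (H i); rewrite Epq.
rewrite /affdim direction_trop_cell // dim_pair_space //; congr (_ + _)%N.
rewrite -/(affdim _) (@affdim_minkowski_sum _ _ _ _
  (fun i => real_point (A (p i))) (fun i => real_point (A (q i)))) // => i.
(* Distinct labels may carry the same point; the segment is then a point and its row in the matrix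
   is zero. *)
rewrite /labelled_points Epq; apply/seteqP; split=> y /=.
  by move=> [j /set2P[]-> <-]; [left|right].
by move=> [->|->]; [exists (p i)|exists (q i)]; rewrite //= ?set21 ?set22.
Qed.

End TropicalCells.

(** * Codimension as an optimum over choices of pairs *)

Theorem theorem2p23 (R : realType) (n k : nat) (m : 'I_k -> nat)
    (hm : forall i, (2 <= m i)%N)
    (A : forall i : 'I_k, 'I_(m i) -> 'rV[int]_n) :
  has_codim (@trop_resultant R n k m A)
    (k%:Z -
     (\max_(E : {dffun forall i : 'I_k, {set 'I_(m i)}} |
              [forall i, #|E i| == 2%N])
        affdim (minkowski_sum
                  (fun i => conv_hull (@labelled_points R n (m i) (A i) (E i)))))%N%:Z).
Proof.
set pairs := [pred E : {dffun forall i : 'I_k, {set 'I_(m i)}} |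
                [forall i, #|E i| == 2%N]].
set mdim := fun E : {dffun forall i : 'I_k, {set 'I_(m i)}} =>
  affdim (minkowski_sum
    (fun i => conv_hull (@labelled_points R n (m i) (A i) (E i)))).
(* A choice of pairs exists since every [m i] is at least 2; hence both maxima below are
   attained. *)
have pairs_gt0 : (0 < #|pairs|)%N.
  have two i : exists E : {set 'I_(m i)}, #|E| == 2%N.
    have : (1 < #|'I_(m i)|)%N by rewrite card_ord.
    by move=> /card_gt1P[a [b [_ _ ab]]]; exists [set a; b]%SET; rewrite cards2 ab.
  have [E HE] := fin_all_exists two.
  apply/card_gt0P; exists [ffun i => E i].
  by rewrite inE; apply/forallP => i; rewrite ffunE.
have pairs2 E : E \in pairs -> forall i, #|E i| = 2%N.
  by rewrite inE => /forallP H i; apply/eqP.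
have cellE E : E \in pairs ->
    (affdim (trop_cell A E : set 'rV[R]__) + k =
     \sum_(i < k) m i + mdim E)%N.
  by move=> /pairs2; apply: affdim_trop_cell.
have dec : cone_decomposition (@trop_resultant R n k m A)
    (fun j : 'I_#|pairs| => trop_cell A (enum_val j)).
  split=> [j|]; first exact: polyhedral_trop_cell.
  rewrite trop_resultantE; apply/seteqP; split=> c.
    move=> [E /= E2 cE]; have Ein : E \in pairs by [].
    by exists (enum_rank_in Ein E) => //; rewrite enum_rankK_in.
  by move=> [j _ cE]; exists (enum_val j) => //=; have := enum_valP j; rewrite inE.
pose cells (j : 'I_#|pairs|) :=
  affdim (trop_cell A (enum_val j) : set 'rV[R]_(\sum_(i < k) m i)).
exists (\max_(j < #|pairs|) cells j)%N.
  exact: cone_decomposition_has_dim dec.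
set M := (\max_(E | _) _)%N; set d := (\max_(j < _) _)%N.
(* The additive form in [nat] avoids truncated subtraction and matches [cellE], which relates the
   two maxima cell by cell. *)
suff dM : (d + k = \sum_(i < k) m i + M)%N.
  apply/eqP; rewrite subr_eq addrAC eq_sym subr_eq.
  by rewrite -[eqbLHS]PoszD -[eqbRHS]PoszD -dM addnC.
apply/eqP; rewrite eqn_leq; apply/andP; split.
  have [|j0 dj0] := @bigop.eq_bigmax _ cells; first by rewrite card_ord.
  rewrite /d dj0 cellE ?enum_valP // leq_add2l.
  exact: (leq_bigmax_cond (F := mdim) _ (enum_valP j0)).
have [E0 E0in ME0] := @bigop.eq_bigmax_cond _ pairs mdim pairs_gt0.
rewrite [M]ME0 -cellE // leq_add2r -(enum_rankK_in E0in E0in).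
exact: (leq_bigmax (F := cells)).
Qed.
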